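(* Let $K$ be a finite simplicial complex and let $V$ be a finite set containing the set $K^0$ of vertices of $K$. If $K$ simplicially collapses to the boundary of a simplex, then the Alexander dual $K^*$ of $K$ with respect to $V$ is homotopy equivalent to a sphere.
   Context: Finite simplicial complexes are abstract: a finite family of finite sets closed under taking subsets. The empty set is regarded as a simplex of every simplicial complex. $K^0$ is the set of vertices of $K$. Given a finite set $V\supseteq K^0$, the Alexander dual of $K$ with respect to $V$ is $K^*=\{\sigma\subseteq V : V\smallsetminus\sigma\notin K\}$. There is an elementary simplicial collapse from $K$ to a subcomplex $L$ if $L=K\smallsetminus\{\tau,\sigma\}$, where $\tau$ is a nonempty free face of $\sigma$ in $K$ (that is, $\dim\tau=\dim\sigma-1$ and $\sigma$ is the only simplex of $K$ properly containing $\tau$). $K$ simplicially collapses to $L$ if there is a finite (possibly empty) sequence of elementary simplicial collapses starting at $K$ and ending at $L$. The boundary of a simplex with vertex set $\tau^0$ is the complex of all proper subsets of $\tau^0$. Homotopy equivalence refers to geometric realizations. *)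

(* Defs.v *)
From mathcomp Require Import all_boot all_order all_algebra.

Set Implicit Arguments.
Unset Strict Implicit.
Unset Printing Implicit Defensive.

Import GRing.Theory Num.Theory.

(* The empty simplex belongs to every simplicial complex; the empty family is
   not a simplicial complex. *)
Definition simplicial_complex (T : finType) (K : {set {set T}}) : Prop :=
  set0 \in K /\ (forall s t : {set T}, s \in K -> t \subset s -> t \in K).

Definition vertices (T : finType) (K : {set {set T}}) : {set T} :=
  [set v | [set v] \in K].

Definition alexander_dual (T : finType) (V : {set T}) (K : {set {set T}}) :
    {set {set T}} :=
  [set s : {set T} | (s \subset V) && (V :\: s \notin K)].

Definition simplex_boundary (T : finType) (t : {set T}) : {set {set T}} :=
  [set s : {set T} | s \proper t].

Definition free_face (T : finType) (K : {set {set T}}) (t s : {set T}) : bool :=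
  [&& t \in K, s \in K, t \proper s, #|s| == #|t|.+1 &
      [forall (r | r \in K), (t \proper r) ==> (r == s)]].

Definition elementary_collapse (T : finType) : rel {set {set T}} :=
  fun K L => [exists t : {set T}, [exists s : {set T},
    [&& t != set0, free_face K t s & L == K :\: [set t; s]]]].

(* [connect] is the reflexive transitive closure. *)
Definition collapses (T : finType) (K L : {set {set T}}) : bool :=
  connect (@elementary_collapse T) K L.

Definition carrier (T : finType) (R : numDomainType) (x : T -> R) : {set T} :=
  [set v | x v != 0%R].

From mathcomp Require Import all_classical all_reals all_analysis.
From mathcomp Require Import subtype_topology.
Import numFieldNormedType.Exports.

Local Open Scope classical_set_scope.
Local Open Scope ring_scope.

(* The points of |K| in barycentric coordinates, inside R^T with the product
   topology. Both {set0} and the empty family have empty realization. *)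
Definition realization (R : realType) (T : finType) (K : {set {set T}}) :
    set {ptws T -> R} :=
  [set x : {ptws T -> R} |
    [/\ forall v, 0 <= x v, \sum_(v : T) x v = 1 & carrier x \in K]].
Arguments realization R {T} K.

(* The unit sphere S^(n-1) of R^n; for n = 0 it is empty. *)
Definition sphere (R : realType) (n : nat) : set 'rV[R]_n :=
  [set x : 'rV[R]_n | \sum_(i < n) x ord0 i ^+ 2 = 1].
Arguments sphere R n : clear implicits.

Definition homotopic (R : realType) (X Y : topologicalType) (f g : X -> Y) :
    Prop :=
  exists H : X * R -> Y,
    [/\ {within [set: X] `*` `[0, 1], continuous H},
        forall x, H (x, 0) = f x & forall x, H (x, 1) = g x].

Definition homotopy_equivalent (R : realType) (X Y : topologicalType) : Prop :=
  exists (f : X -> Y) (g : Y -> X),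
    [/\ continuous f, continuous g,
        homotopic R (g \o f) idfun & homotopic R (f \o g) idfun].

(* Main.v *)
Require Import Defs.
From mathcomp Require Import all_boot all_order all_algebra.
From mathcomp Require Import all_classical all_reals all_analysis.
From mathcomp Require Import subtype_topology.
Import numFieldNormedType.Exports.
From mathcomp Require Import ring lra zify.
Import Order.TTheory GRing.Theory Num.Theory.

(** Alexander duality reverses elementary collapses: if t is a free face of s in
    K and V is not in K, then V \ s is a nonempty free face of V \ t in the dual
    of K \ {t, s}, and removing these two simplices gives the dual of K. Hence
    the dual of the boundary of t deformation retracts onto the dual of K. With
    U = V \ t and v a vertex of t, it also deformation retracts onto the
    boundary of the simplex U + v, by moving all the mass on t to v, and that
    boundary is homeomorphic to the sphere of dimension #|U| - 1. When t is not
    contained in V, it is a single vertex, and any vertex of V can play its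
    role. When V is in K, the dual is empty, like the sphere in R^0. *)

(** * Continuity of composites, pairs and coordinatewise defined maps *)

Section Composition.
Local Open Scope classical_set_scope.
Context {X Y Z : topologicalType}.

Lemma continuous_compose (f : X -> Y) (g : Y -> Z) :
  continuous f -> continuous g -> continuous (fun x => g (f x)).
Proof. by move=> cf cg x; apply: continuous_comp; [exact: cf|exact: cg]. Qed.

Lemma continuous_pair (f : X -> Y) (g : X -> Z) :
  continuous f -> continuous g -> continuous (fun x => (f x, g x)).
Proof. by move=> cf cg x; apply: cvg_pair; [exact: cf|exact: cg]. Qed.

Lemma continuous_fst : continuous (fun x : X * Y => x.1).
Proof. by move=> x; exact: cvg_fst. Qed.

Lemma continuous_snd : continuous (fun x : X * Y => x.2).
Proof. by move=> x; exact: cvg_snd. Qed.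

Lemma continuous_const (y : Y) : continuous (fun _ : X => y).
Proof. by move=> x; exact: cvg_cst. Qed.

End Composition.

Section Continuity.
Local Open Scope ring_scope.
Local Open Scope classical_set_scope.
Context {R : realType} {X : topologicalType}.

(** The product topology is the supremum of the topologies induced by the evaluations, so
    convergence is tested one coordinate at a time. *)
Lemma continuous_ptws (T : Type) (f : X -> {ptws T -> R}) :
  (forall v, continuous (fun x => f x v)) -> continuous f.
Proof.
move=> cf x; apply/cvg_sup => v U [_ [[W oW <-] Wfx] WU].
apply: (@filterS _ (nbhs (x : X)) _ _ _ _ (cf v x W _)).
  by move=> y Wy; exact: WU.
exact: open_nbhs_nbhs.
Qed.

Lemma continuous_rV (n : nat) (f : X -> 'rV[R]_n) :
  (forall i, continuous (fun x => f x ord0 i)) -> continuous f.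
Proof.
move=> cf x A [P nP PA].
have Pi i : \forall y \near x, P ord0 i (f y ord0 i) by exact: cf (nP _ _).
have Pf : \forall y \near x, forall i,
  P ord0 i (f y ord0 i) by exact: filter_forall.
change (nbhs x (f @^-1` A)).
apply: filterS Pf => y Py; apply: PA => i j; rewrite (ord1 i); exact: Py.
Qed.

Lemma continuous_set_type (Y : topologicalType) (A : set Y) (f : X -> A) :
  continuous (fun x => set_val (f x)) -> continuous f.
Proof. by move=> cf; apply: continuous_comp_initial. Qed.

Lemma continuous_sum (I : Type) (r : seq I) (P : pred I) (F : I -> X -> R) :
  (forall i, P i -> continuous (F i)) ->
  continuous (fun x => \sum_(i <- r | P i) F i x).
Proof.
move=> cF x; apply: (@cvg_big R I +%R 0 P _ X (nbhs x)) => [|i Pi];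
  last exact: cF.
exact: add_continuous.
Qed.

Lemma continuous_maxr (f g : X -> R) :
  continuous f -> continuous g -> continuous (fun x => Num.max (f x) (g x)).
Proof.
by move=> cf cg x; apply: (@continuous_max R X f g); [exact: cf|exact: cg].
Qed.

Lemma continuous_minr (f g : X -> R) :
  continuous f -> continuous g -> continuous (fun x => Num.min (f x) (g x)).
Proof.
by move=> cf cg x; apply: (@continuous_min R X f g); [exact: cf|exact: cg].
Qed.

Lemma continuous_bigmin (I : Type) (r : seq I) (P : pred I) (F0 : X -> R) (F :
  I -> X -> R) :
  continuous F0 -> (forall i, P i -> continuous (F i)) ->
  continuous (fun x => \big[Num.min/F0 x]_(i <- r | P i) F i x).
Proof.
move=> cF0 cF; elim: r => [|i r IH].
  by rewrite (_ : (fun x => _) = F0) //; apply/funext => x; rewrite big_nil.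
case Pi: (P i); last first.
  rewrite (_ : (fun x => _) = fun x => \big[Num.min/F0 x]_(j <- r | P j) F j x);
    first exact: IH.
  by apply/funext => x; rewrite big_cons Pi.
rewrite (_ : (fun x => _) =
    F i \min (fun x => \big[Num.min/F0 x]_(j <- r | P j) F j x)).
  by move=> x; apply: continuous_min; [exact: cF|exact: IH].
by apply/funext => x; rewrite big_cons Pi.
Qed.

Lemma continuous_mul (f g : X -> R) :
  continuous f -> continuous g -> continuous (fun x => f x * g x).
Proof. by move=> cf cg x; apply: continuousM; [exact: cf|exact: cg]. Qed.

Lemma continuous_add (f g : X -> R) :
  continuous f -> continuous g -> continuous (fun x => f x + g x).
Proof. by move=> cf cg x; apply: cvgD; [exact: cf|exact: cg]. Qed.

Lemma continuous_sub (f g : X -> R) :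
  continuous f -> continuous g -> continuous (fun x => f x - g x).
Proof. by move=> cf cg x; apply: cvgB; [exact: cf|exact: cg]. Qed.

Lemma continuous_div (f g : X -> R) :
  continuous f -> continuous g -> (forall x, g x != 0) ->
  continuous (fun x => f x / g x).
Proof.
move=> cf cg g0; apply: continuous_mul => // x.
by apply: continuousV; [exact: g0|exact: cg].
Qed.

End Continuity.

Lemma ptws_eval_continuous {R : realType} {T : eqType} (v : T) :
  continuous (fun x : {ptws T -> R} => x v).
Proof. exact: (@proj_continuous _ (fun _ : T => R) v). Qed.

(** * Strong deformation retractions between realizations *)

Section Retraction.
Local Open Scope ring_scope.
Local Open Scope classical_set_scope.
Context {R : realType} {T : finType}.
Implicit Types M N P : {set {set T}}.

(* Time runs from the retraction at 0 to the identity at 1. The homotopy lives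
   on the whole of R^T and is the identity there at time 1, so that
   concatenation is given by a formula and needs no pasting. *)
Definition deformation_retracts M N :=
  realization R N `<=` realization R M /\
  exists h : {ptws T -> R} * R -> {ptws T -> R},
  [/\ continuous h, forall x, h (x, 1) = x,
      forall x t, 0 <= t <= 1 -> realization R M x ->
        realization R M (h (x, t)),
      forall x, realization R M x -> realization R N (h (x, 0)) &
      forall x t, realization R N x -> h (x, t) = x].

Lemma deformation_retracts_refl M : deformation_retracts M M.
Proof.
split=> //; exists fst; split=> //.
by move=> x; exact: cvg_fst.
Qed.

(** The concatenation is k(h(x, a(t)), b(t)). Up to time 1/2, [a] is 0 and [k] moves the retracted
    point h(x, 0); from then on [b] is 1, [k] is the identity and [h] runs. *)
Lemma deformation_retracts_trans M N P : deformation_retracts M N ->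
  deformation_retracts N P -> deformation_retracts M P.
Proof.
move=> [NM [h [ch h1 hM hN hfix]]] [PN [k [ck k1 kN kP kfix]]].
split; first exact: subset_trans NM.
pose a (t : R) := Num.max 0 (2 * t - 1); pose b (t : R) := Num.min 1 (2 * t).
exists (fun xt => k (h (xt.1, a xt.2), b xt.2)); split.
- have c2 : continuous (fun t : R => 2 * t).
    by apply: continuous_mul => t; [exact: cvg_cst|exact: cvg_id].
  have ca : continuous a.
    apply: continuous_maxr; first exact: continuous_const.
    by apply: continuous_sub; last exact: continuous_const.
  have cb : continuous b.
    by apply: continuous_minr; first exact: continuous_const.
  apply: (continuous_compose (fun xt => (h (xt.1, a xt.2), b xt.2)) k) => //.
  apply: continuous_pair;
    last exact: (continuous_compose _ b continuous_snd cb).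
  apply: (continuous_compose (fun xt => (xt.1, a xt.2)) h) => //.
  apply: continuous_pair; first exact: continuous_fst.
  exact: (continuous_compose _ a continuous_snd ca).
- move=> x /=; have -> : b 1 = 1 by rewrite /b min_l//; lra.
  by rewrite k1 (_ : a 1 = 1) // /a max_r; lra.
- move=> x t t01 Mx /=; have [tl|tg] := leP t 2^-1.
    rewrite (_ : a t = 0); last by rewrite /a max_l; lra.
    apply: NM; apply: kN; last exact: hN.
    by rewrite /b min_r; lra.
  rewrite (_ : b t = 1); last by rewrite /b min_l; lra.
  rewrite k1; apply: hM => //; rewrite /a max_r; lra.
- move=> x Mx /=; rewrite (_ : a 0 = 0); last by rewrite /a max_l; lra.
  rewrite (_ : b 0 = 0); last by rewrite /b min_r; lra.
  by apply: kP; exact: hN.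
- by move=> x t Px /=; rewrite hfix ?kfix//; exact: PN.
Qed.

Lemma carrierP (x : T -> R) v : (v \in carrier x) = (x v != 0).
Proof. by rewrite inE. Qed.

(** The segment from phi(x) to x lies in the simplex spanned by the union of the two carriers, which
    is assumed to be in [M]. *)
Lemma deformation_retracts_straight M N (phi : {ptws T -> R} -> {ptws T -> R}) :
  simplicial_complex M -> N \subset M -> continuous phi ->
  (forall x, realization R M x -> realization R N (phi x)) ->
  (forall x, realization R M x -> carrier x :|: carrier (phi x) \in M) ->
  (forall x, realization R N x -> phi x = x) ->
  deformation_retracts M N.
Proof.
move=> [_ cM] NM cphi phiN phiM phifix; split.
  by move=> x [x0 x1 xN]; split=> //; exact: (fintype.subsetP NM).
have ct v := @ptws_eval_continuous R T v.
exists (fun xt v => phi xt.1 v + xt.2 * (xt.1 v - phi xt.1 v)); split.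
- have c1 v : continuous (fun xt : {ptws T -> R} * R => xt.1 v).
    exact: (continuous_compose _ _ continuous_fst (ct v)).
  have c2 v : continuous (fun xt : {ptws T -> R} * R => phi xt.1 v).
    apply: (continuous_compose (fun xt => phi xt.1) (fun x => x v)) => //.
    exact: (continuous_compose _ _ continuous_fst cphi).
  apply: continuous_ptws => v; apply: continuous_add => //.
  apply: continuous_mul; first exact: continuous_snd.
  exact: continuous_sub.
- by move=> x; apply/funext => v /=; rewrite mul1r addrC subrK.
- move=> x t /= /andP[t0 t1] Mx; have [y0 y1 _] := phiN x Mx;
    have [x0 x1 _] := Mx.
  split=> [v||].
  + have := x0 v; have := y0 v; nra.
  + by rewrite big_split/= -mulr_sumr sumrB x1 y1 subrr mulr0 addr0.
  + apply: (cM _ _ (phiM x Mx)); apply/fintype.subsetP => v.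
    rewrite !inE -negb_and; apply: contra => /andP[/eqP-> /eqP->].
    by apply/eqP; ring.
- move=> x Mx; have := phiN x Mx; congr (realization R N _).
  by apply/funext => v /=; rewrite mul0r addr0.
- by move=> x t Nx; apply/funext => v /=; rewrite phifix// subrr mulr0 addr0.
Qed.

Lemma clamp_continuous : continuous (fun t : R => Num.max 0 (Num.min 1 t)).
Proof.
apply: continuous_maxr => [t|]; first exact: cvg_cst.
by apply: continuous_minr => t; [exact: cvg_cst|exact: cvg_id].
Qed.

(* Both spaces being retracts of the same |M|, the two homotopies are each
   obtained from a single one, and no transitivity is needed. *)
Lemma retracts_homotopy_equivalent M A B (Y : topologicalType)
    (f : realization R B -> Y) (g : Y -> realization R B) :
  deformation_retracts M A -> deformation_retracts M B ->
  continuous f -> continuous g -> cancel f g -> cancel g f ->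
  homotopy_equivalent R (realization R A) Y.
Proof.
move=> [AM [h [ch h1 hM hA hfix]]] [BM [k [ck k1 kM kB kfix]]] cf cg fK gK.
(* [homotopic] asks for a map at all real times, but [h] and [k] are known to preserve |M| only for
   times in [0, 1]; hence the time is clamped. *)
pose c (t : R) := Num.max 0 (Num.min 1 t).
have c01 t : 0 <= c t <= 1.
  by rewrite /c le_max lexx/= ge_max ler01 ge_min lexx.
have c0 : c 0 = 0 by rewrite /c min_r ?ler01 // max_l.
have c1 : c 1 = 1 by rewrite /c min_l // max_r.
pose mk C (x : {ptws T -> R}) (Cx : realization R C x) : realization R C :=
  @exist _ (fun z => z \in realization R C) x (mem_set Cx).
have ir (C : {set {set T}}) : continuous (fun x : realization R C => set_val x).
  exact: initial_continuous.
have inA (x : realization R A) : realization R M (set_val x).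
  by apply: AM; exact: set_valP.
have inB (x : realization R B) : realization R M (set_val x).
  by apply: BM; exact: set_valP.
pose q (x : realization R A) : realization R B := mk _ _ (kB _ (inA x)).
pose r (y : realization R B) : realization R A := mk _ _ (hA _ (inB y)).
have cq : continuous q.
  apply: continuous_set_type; apply: (continuous_compose _ k) => //.
  by apply: continuous_pair; [exact: ir|exact: continuous_const].
have cr : continuous r.
  apply: continuous_set_type; apply: (continuous_compose _ h) => //.
  by apply: continuous_pair; [exact: ir|exact: continuous_const].
(* A point of |A| is moved by [k] inside |M|, then retracted to |A| by [h] at time 0. This starts at
   [r \o q] and ends at the identity. *)
have HA (xt : realization R A * R) :
    realization R A (h (k (set_val xt.1, c xt.2), 0)).
  by apply/hA/kM => //; exact: inA.
have HB (xt : realization R B * R) :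
    realization R B (k (h (set_val xt.1, c xt.2), 0)).
  by apply/kB/hM => //; exact: inB.
have cp (C : {set {set T}}) :
    continuous (fun xt : realization R C * R => (set_val xt.1, c xt.2)).
  apply: continuous_pair;
    first exact: (continuous_compose _ set_val continuous_fst (ir C)).
  exact: (continuous_compose _ _ continuous_snd clamp_continuous).
exists (f \o q), (r \o g); split.
- exact: (continuous_compose q f).
- exact: (continuous_compose g r).
- exists (fun xt => mk _ _ (HA xt)); split.
  + apply: continuous_subspaceT; apply: continuous_set_type.
    apply: (continuous_compose _ h) => //.
    apply: continuous_pair; last exact: continuous_const.
    exact: (continuous_compose _ k (cp _)).
  + by move=> x; apply: val_inj => /=; rewrite fK /= c0.
  + move=> x; apply: val_inj => /=.
    by rewrite c1 k1 hfix //; exact: set_valP.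
- exists (fun yt => f (mk _ _ (HB (g yt.1, yt.2)))); split.
  + apply: continuous_subspaceT; apply: (continuous_compose _ f) => //.
    apply: continuous_set_type; apply: (continuous_compose _ k) => //.
    apply: continuous_pair; last exact: continuous_const.
    apply: (continuous_compose _ h) => //.
    apply: (continuous_compose (fun yt => (g yt.1, yt.2)) _ _ (cp _)).
    apply: continuous_pair; last exact: continuous_snd.
    exact: (continuous_compose _ _ continuous_fst cg).
  + by move=> y; congr f; apply: val_inj => /=; rewrite c0.
  + move=> y; rewrite /= -[RHS]gK; congr f; apply: val_inj => /=.
    by rewrite c1 h1 kfix //; exact: set_valP.
Qed.
End Retraction.

(** * Combinatorics of Alexander duals and elementary collapses *)

Section Dual.
Context {T : finType}.
Implicit Types (K L : {set {set T}}) (V s t : {set T}).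

Lemma setDDK V s : s \subset V -> V :\: (V :\: s) = s.
Proof.
move=> sV; rewrite finset.setDDr finset.setDv finset.set0U.
exact/finset.setIidPr.
Qed.

(** Complements reverse inclusions, whence closure under subsets; [V] not being in [K] makes the
    empty set a simplex of the dual. *)
Lemma simplicial_complex_dual V K : simplicial_complex K -> V \notin K ->
  simplicial_complex (alexander_dual V K).
Proof.
move=> [_ cK] VK; split; first by rewrite inE finset.sub0set finset.setD0.
move=> s t; rewrite !inE => /andP[sV VsK] ts.
rewrite (fintype.subset_trans ts sV)/=.
by apply: contra VsK => /cK; apply; exact: finset.setDS.
Qed.

Lemma subset_vertices V K : simplicial_complex K -> vertices K \subset V ->
  forall s, s \in K -> s \subset V.
Proof.
move=> [_ cK] KV s sK; apply/fintype.subsetP => v vs.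
apply: (fintype.subsetP KV); rewrite inE; apply: (cK s) => //.
by rewrite finset.sub1set.
Qed.

Lemma free_face_eq K t s r : free_face K t s -> r \in K -> t \subset r ->
  r = t \/ r = s.
Proof.
move=> /and5P[_ _ _ _ /forallP/(_ r)/implyP fr] rK tr.
have [->|rt] := eqVneq r t; first by left.
right; apply/eqP; apply: (implyP (fr rK)).
by rewrite finset.properEneq eq_sym rt.
Qed.

(** A simplex of [K] other than [t] and [s] has neither of them as a face, since it would contain
    [t]. The empty simplex survives because [t] is nonempty. *)
Lemma simplicial_complex_collapse K t s :
  simplicial_complex K -> free_face K t s -> t != finset.set0 ->
  simplicial_complex (K :\: [set t; s]).
Proof.
move=> [K0 cK] fts t0.
have /and5P[tK sK ts _ _] := fts; have tss := fintype.proper_sub ts.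
split.
  rewrite !inE K0 andbT negb_or eq_sym t0 eq_sym /=;
    apply: contra t0 => /eqP s0.
  by move: tss; rewrite s0 finset.subset0.
move=> r q; rewrite !inE !negb_or => /andP[/andP[rt rs] rK] qr.
rewrite (cK _ _ rK qr) andbT.
suff tq : ~~ (t \subset q).
  by apply/andP; split; apply: contra tq => /eqP->.
apply/negP => tq.
have := free_face_eq K t s r fts rK (fintype.subset_trans tq qr).
by case => e; move: rt rs; rewrite e eqxx.
Qed.

(** If a dual simplex [r] properly contains V \ s, then V \ r is a face of [s], so it is in [K];
    being outside K \ {t, s}, it is [t] or [s], and properness excludes [s]. *)
Lemma free_face_dual V K t s : simplicial_complex K ->
  (forall r, r \in K -> r \subset V) -> free_face K t s ->
  free_face (alexander_dual V (K :\: [set t; s])) (V :\: s) (V :\: t).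
Proof.
move=> [_ cK] KV fts.
have /and5P[tK sK ts /eqP cts _] := fts; have tss := fintype.proper_sub ts.
have [tV sV] := (KV _ tK, KV _ sK).
apply/and5P; split.
- by rewrite !inE finset.subsetDl setDDK // eqxx orbT.
- by rewrite !inE finset.subsetDl setDDK // eqxx.
- rewrite finset.properEcard finset.setDS //= !finset.cardsDS // cts.
  by have := fintype.subset_leq_card sV; rewrite cts; lia.
- rewrite !finset.cardsDS // cts.
  by have := fintype.subset_leq_card sV; rewrite cts; lia.
- apply/forallP => r; apply/implyP; rewrite inE => /andP[rV rL];
    apply/implyP => pr.
  have qs : V :\: r \subset s.
    by rewrite -(setDDK _ _ sV) finset.setDS //; exact: fintype.proper_sub.
  have qK : V :\: r \in K := cK _ _ sK qs.
  move: rL; rewrite !inE qK andbT negbK => /orP[]/eqP e.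
    by rewrite -e setDDK.
  by move: pr; rewrite -e setDDK // fintype.properxx.
Qed.

(** Deleting [t] and [s] from [K] adds exactly their complements to the dual. *)
Lemma dual_collapse V K t s : (forall r, r \in K -> r \subset V) ->
  free_face K t s ->
  alexander_dual V (K :\: [set t; s]) :\: [set V :\: s; V :\: t] =
  alexander_dual V K.
Proof.
move=> KV fts; have /and5P[tK sK _ _ _] := fts.
have [tV sV] := (KV _ tK, KV _ sK).
apply/finset.setP => r; rewrite !inE.
have [rV|] := boolP (r \subset V); last by rewrite !andbF.
have e (u : {set T}) : u \subset V -> (r == V :\: u) = (V :\: r == u).
  by move=> uV; apply/eqP/eqP => [->|<-]; rewrite setDDK.
rewrite !e //= negb_and negbK.
have [->|] := eqVneq (V :\: r) t; first by rewrite tK orbT.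
by have [->|] := eqVneq (V :\: r) s; first by rewrite sK.
Qed.

End Dual.

(** * Deformation retractions realizing the collapses *)

Section Collapse.
Local Open Scope ring_scope.
Context {R : realType} {T : finType}.
Implicit Types (K M : {set {set T}}) (V s t a b : {set T}).

(** The simplex [b] is [a] with one more vertex [p]. Points are pushed in the direction from the
    barycenter of [a] to [p] until a coordinate on [a] vanishes. Only points with carrier [a] or [b]
    move, and they stay in the simplex [b]. *)
Lemma collapse_retracts M a b : simplicial_complex M -> a != finset.set0 ->
  free_face M a b -> @deformation_retracts R T M (M :\: [set a; b]).
Proof.
move=> cM /finset.set0Pn[u0 u0a] fab.
have /and5P[aM bM ab /eqP cab _] := fab; have sab := fintype.proper_sub ab.
have [p bE] : exists p, b :\: a = [set p].
  by apply/cards1P; rewrite finset.cardsDS // cab subSnn.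
have pb : p \in b by have := finset.set11 p; rewrite -bE inE => /andP[].
(* The default value is itself a coordinate on [a], so it does not affect the minimum. *)
pose m (x : {ptws T -> R}) : R := \big[Num.min/x u0]_(u in a) x u.
(* The smallest coordinate on the free face is removed from all its vertices and
   the mass is given to the remaining vertex p of b. *)
pose phi (x : {ptws T -> R}) : {ptws T -> R} := fun v =>
  x v - (if v \in a then m x else 0) + (if v == p then m x *+ #|a| else 0).
have cm : continuous m.
  apply: continuous_bigmin => [|u _]; exact: ptws_eval_continuous.
have m_le x u : u \in a -> m x <= x u by move=> ua; exact: bigmin_le_cond.
have m_ex x : exists2 u, u \in a & m x = x u.
  rewrite /m; elim/big_ind: _ => [|y z [u ua ->] [w wa ->]|u ua];
    [by exists u0| |by exists u].
  by rewrite /Num.min; case: ifP => _; [exists u|exists w].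
have m0 x : realization R M x -> 0 <= m x.
  by move=> [x0 _ _]; have [u _ ->] := m_ex x.
have phi_id x : m x = 0 -> phi x = x.
  by move=> e; apply/funext => v; rewrite /phi e mul0rn !if_same subr0 addr0.
have carrier_lt x : realization R M x -> ~~ (a \subset carrier x) -> m x = 0.
  move=> Mx /subsetPn[u ua]; rewrite carrierP negbK => /eqP xu.
  by apply/le_anti/andP; split; [rewrite -xu m_le|exact: m0].
have carrier_b x : realization R M x -> a \subset carrier x ->
    carrier x \subset b /\ carrier (phi x) \subset b.
  move=> [_ _ xM] acx.
  have xb : carrier x \subset b.
    by case: (free_face_eq _ _ _ _ fab xM acx) => ->.
  split=> //; apply/fintype.subsetP => v; rewrite carrierP;
    apply: contraNT => vb.
  have va : v \notin a by apply: contra vb; exact: (fintype.subsetP sab).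
  have -> : phi x v = x v.
    rewrite /phi (negbTE va) subr0; case: eqP => [vp|]; last by rewrite addr0.
    by move: vb; rewrite vp pb.
  by apply: contraNT vb; rewrite -carrierP; exact: (fintype.subsetP xb).
apply: (deformation_retracts_straight M _ phi) => //.
- exact: finset.subsetDl.
- apply: continuous_ptws => v; apply: continuous_add.
    apply: continuous_sub; first exact: ptws_eval_continuous.
    by case: (v \in a); [exact: cm|exact: continuous_const].
  case: eqP => _; last exact: continuous_const.
  have -> : (fun x => m x *+ #|a|) = (fun x => m x * #|a|%:R).
    by apply/funext => x; rewrite mulr_natr.
  by apply: continuous_mul => //; exact: continuous_const.
- move=> x Mx; have [x0 x1 xM] := Mx; split.
  + move=> v; rewrite /phi addr_ge0 //; last first.
      by case: ifP => // _; rewrite mulrn_wge0 // m0.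
    by case: ifP => [va|_]; rewrite ?subr0 // subr_ge0 m_le.
  + rewrite /phi big_split sumrB /= x1 -big_mkcond /= sumr_const.
    by rewrite -big_mkcond /= big_pred1_eq subrK.
  + have [acx|acx] := boolP (a \subset carrier x); last first.
      rewrite phi_id ?carrier_lt // !inE xM andbT negb_or.
      by apply/andP; split; apply: contra acx => /eqP->.
    (* A vertex [u] of [a] where the minimum is attained leaves the carrier; as [p] is not in [a],
       it gets no mass back. So the new carrier is neither [a] nor [b]. *)
    have [u ua mu] := m_ex x.
    have ucx : u \notin carrier (phi x).
      rewrite carrierP negbK /phi ua mu subrr add0r; case: (u =P p) => [up|];
        last by rewrite eqxx.
      by have := finset.set11 p; rewrite -bE inE => /andP[pa _]; move: pa;
        rewrite -up ua.
    rewrite !inE negb_or; apply/andP; split.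
      apply/andP; split; apply: contra ucx => /eqP->//.
      exact: (fintype.subsetP sab).
    by have [_ cb] := carrier_b x Mx acx; apply: (proj2 cM _ _ bM cb).
- move=> x Mx; have [acx|acx] := boolP (a \subset carrier x).
    have [xb pxb] := carrier_b x Mx acx.
    by apply: (proj2 cM _ _ bM); rewrite finset.subUset xb.
  by rewrite phi_id ?carrier_lt // finset.setUid; case: Mx.
- move=> x [x0 x1 xN]; have Mx : realization R M x.
    by split=> //; move: xN; rewrite inE => /andP[].
  apply/phi_id/carrier_lt => //; apply/negP => acx.
  have [_ _ xM] := Mx.
  by move: xN; case: (free_face_eq _ _ _ _ fab xM acx) => ->;
    rewrite !inE eqxx ?orbT.
Qed.

(** Induction along the collapse: each step enlarges the dual by a pair of simplices, and the larger
    dual retracts onto the smaller one. These retractions compose in the reverse order. *)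
Lemma dual_retracts V K L : simplicial_complex K ->
  (forall r, r \in K -> r \subset V) -> V \notin K -> collapses K L ->
  [/\ simplicial_complex L, forall r, r \in L -> r \subset V, V \notin L &
      @deformation_retracts R T (alexander_dual V L) (alexander_dual V K)].
Proof.
move=> + + + /connectP[p]; elim: p K => [|K' p IH] K /= cK KV VK.
  by move=> _ ->; split=> //; exact: deformation_retracts_refl.
case/andP => /existsP[t /existsP[s /and3P[t0 fts /eqP K'E]]] pK' LE.
have cK' : simplicial_complex K'.
  by rewrite K'E; exact: simplicial_complex_collapse.
have K'V r : r \in K' -> r \subset V by rewrite K'E inE => /andP[_ /KV].
have VK' : V \notin K' by rewrite K'E inE negb_and VK orbT.
have [cL LV VL ret] := IH K' cK' K'V VK' pK' LE.
split=> //; apply: deformation_retracts_trans ret _.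
rewrite -(dual_collapse _ _ _ _ KV fts) -K'E.
apply: collapse_retracts; first exact: simplicial_complex_dual.
  (* If V \ s were empty, [s] would be [V], which is not in [K]. *)
  rewrite finset.setD_eq0; apply: contra VK => Vs.
  have /and5P[_ sK _ _ _] := fts.
  by have /eqP <- : s == V by rewrite finset.eqEsubset Vs KV.
by rewrite K'E; exact: free_face_dual.
Qed.

(** With U = V \ t, the dual consists of the subsets of U and of all unions of a proper subset of U
    with a subset of [t]. Shrinking [t] to its vertex [v] turns it into the boundary of the simplex
    on [v] and U. *)
Lemma dual_boundary_retracts V t v : t \subset V -> v \in t ->
  @deformation_retracts R T (alexander_dual V (simplex_boundary t))
    (simplex_boundary (v |: (V :\: t))).
Proof.
move=> tV vt; pose U := V :\: t.
pose X := alexander_dual V (simplex_boundary t).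
have XE s :
    (s \in X) = (s \subset V) && ~~ ((U \subset s) && ~~ [disjoint s & t]).
  rewrite !inE; have [sV|//] /= := boolP (s \subset V); congr (~~ _).
  rewrite properE; congr (_ && _).
    by rewrite !finset.subDset finset.setUC.
  congr (~~ _); rewrite finset.disjoints_subset.
  apply/fintype.subsetP/fintype.subsetP => st w ws.
    by rewrite inE; apply/negP => /st; rewrite inE ws.
  by rewrite inE (fintype.subsetP tV) // andbT; apply/negP => /st;
    rewrite inE ws.
have cX : simplicial_complex X.
  apply: simplicial_complex_dual; last by rewrite inE properE tV andbF.
  split.
    by rewrite inE properE finset.sub0set; apply/subsetPn; exists v => //;
      rewrite inE.
  by move=> r q; rewrite !inE => rt qr; exact: sub_proper_trans rt.
(* The linear extension of the vertex map sending all of [t] to [v] and fixing the other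
   vertices. *)
pose phi (x : {ptws T -> R}) : {ptws T -> R} := fun w =>
  if w == v then \sum_(u in t) x u else if w \in t then 0 else x w.
have cphi : continuous phi.
  apply: continuous_ptws => w; rewrite /phi; case: (w =P v) => _.
    by apply: continuous_sum => u _; exact: ptws_eval_continuous.
  by case: (w \in t); [exact: continuous_const|exact: ptws_eval_continuous].
have phi_disj (x : {ptws T -> R}) : [disjoint carrier x & t] -> phi x = x.
  move=> /pred0P d; have xt w : w \in t -> x w = 0.
    by move=> wt; have /negbT := d w;
      rewrite /= wt andbT carrierP negbK => /eqP.
  apply/funext => w; rewrite /phi; case: (w =P v) => [->|_].
    by rewrite xt // big1.
  by case: ifP => // /xt ->.
have phi_carrier x : carrier (phi x) \subset v |: (carrier x :\: t).
  apply/fintype.subsetP => w; rewrite !inE /phi;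
    case: (w =P v) => //= _.
  by case: ifP => //; rewrite eqxx.
apply: (deformation_retracts_straight _ _ phi) => //.
- apply/fintype.subsetP => s; rewrite XE inE => sU.
  have sV : s \subset V.
    apply: fintype.subset_trans (fintype.proper_sub sU) _.
    by rewrite finset.subUset finset.sub1set (fintype.subsetP tV) //
      finset.subsetDl.
  rewrite sV /=; apply/negP => /andP[Us /pred0Pn[w /andP[/= ws wt]]].
  move: sU; rewrite properE => /andP[sU /negP]; apply;
    rewrite finset.subUset Us andbT finset.sub1set.
  have := fintype.subsetP sU w ws; rewrite !inE wt /= orbF => /eqP <- //.
- move=> x Xx; have [x0 x1 xX] := Xx; split.
  + move=> w; rewrite /phi; case: (w =P v) => _; first by apply: sumr_ge0.
    by case: ifP.
  + rewrite (bigID (mem t)) /= (bigD1 v) //= [X in _ + X + _]big1 ?addr0;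
      last first.
      by move=> w /andP[wt /negbTE wv]; rewrite /phi wv wt.
    rewrite {1}/phi eqxx -x1 [RHS](bigID (mem t)) /=; congr (_ + _).
    apply: eq_bigr => w wt; rewrite /phi (negbTE wt).
    by case: (w =P v) => // wv; move: wt; rewrite wv vt.
  (* Either the carrier misses a vertex [w] of [U], and [phi] does not bring it back, or it is
     disjoint from [t]; then [x] is fixed and [v] is the missing vertex. *)
  + move: (xX); rewrite XE inE => /andP[xV].
    have vU : v \notin U by rewrite inE vt.
    rewrite negb_and negbK => /orP[/subsetPn[w wU wx]|d];
      apply/fintype.properP; split.
    * apply: fintype.subset_trans (phi_carrier x) _.
      by apply: finset.setUS; exact: finset.setSD.
    * exists w; first by rewrite !inE in wU *; rewrite wU orbT.
      apply: contra wx => /(fintype.subsetP (phi_carrier x)).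
      rewrite !inE => /orP[/eqP wv|/andP[]//].
      by move: vU; rewrite -wv wU.
    * rewrite phi_disj //; apply: fintype.subset_trans (finset.subsetUr _ _).
      by rewrite finset.subsetD xV.
    * exists v; first by rewrite !inE eqxx.
      rewrite phi_disj //; apply/negP => vx.
      by have /pred0P/(_ v) := d; rewrite /= vx vt.
- move=> x Xx; have [_ _ xX] := Xx.
  move: (xX); rewrite !XE => /andP[xV].
  rewrite negb_and negbK => /orP[/subsetPn[w wU wx]|d]; last first.
    by rewrite phi_disj // finset.setUid xV d andbF.
  have cc : carrier x :|: carrier (phi x) \subset v |: carrier x.
    rewrite finset.subUset finset.subsetUr /=.
    by apply: fintype.subset_trans (phi_carrier x) _; apply: finset.setUS;
      exact: finset.subsetDl.
  apply/andP; split.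
    apply: fintype.subset_trans cc _.
    by rewrite finset.subUset finset.sub1set (fintype.subsetP tV).
  rewrite negb_and; apply/orP; left; apply/subsetPn; exists w => //.
  apply: contra wx => /(fintype.subsetP cc);
    rewrite in_setU1 => /orP[/eqP wv|//].
  by move: wU; rewrite wv inE vt.
- move=> x [_ _]; rewrite inE => /fintype.proper_sub xU.
  have xt w : w \in t -> w != v -> x w = 0.
    move=> wt wv; apply/eqP; rewrite -[_ == _]negbK -carrierP; apply/negP.
    by move=> /(fintype.subsetP xU); rewrite !inE (negbTE wv) wt.
  apply/funext => w; rewrite /phi; case: (w =P v) => [->|/eqP wv].
    by rewrite (bigD1 v) //= big1 ?addr0 // => u /andP[]; exact: xt.
  by case: ifP => // wt; rewrite xt.
Qed.
End Collapse.

(** * Homeomorphism between the boundary of a simplex and a sphere *)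

Section Sphere.
Local Open Scope ring_scope.
Local Open Scope classical_set_scope.
Context {R : realType} {T : finType} (v : T) (U : {set T})
  (vU : v \notin U).

Let n := #|U|.
Let W := v |: U.
Let e (i : 'I_n) : T := enum_val i.

Let eU i : e i \in U. Proof. exact: enum_valP. Qed.
Let vW : v \in W. Proof. by rewrite !inE eqxx. Qed.
Let eW i : e i \in W. Proof. by rewrite !inE eU orbT. Qed.

Let WP w : w \in W -> w = v \/ exists i, w = e i.
Proof.
rewrite !inE => /orP[/eqP->|wU]; [by left|right].
by exists (enum_rank_in wU w); rewrite /e enum_rankK_in.
Qed.

(* Barycentric coordinates on the boundary of W correspond to R^n by subtracting
   the coordinate at v; the inverse uses that the smallest coordinate is 0. *)
Let diff (x : {ptws T -> R}) (i : 'I_n) : R := x (e i) - x v.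
Let norm (x : {ptws T -> R}) : R := Num.sqrt (\sum_i diff x i ^+ 2).
Let to_sphere (x : {ptws T -> R}) : 'rV[R]_n := \row_i (diff x i / norm x).

(** This is the minimum of [y] extended by 0 at [v]: the starting value 0 stands for that
    coordinate. Subtracting it in [shift], where the sum picks the coordinate at [w] and is empty
    for [v], makes the minimum on [W] equal to 0. *)
Let low (y : 'rV[R]_n) : R := \big[Num.min/0]_i y ord0 i.
Let shift (y : 'rV[R]_n) (w : T) : R :=
  if w \in W then \sum_(i | e i == w) y ord0 i - low y else 0.
Let mass (y : 'rV[R]_n) : R := \sum_w shift y w.
Let of_sphere (y : 'rV[R]_n) : {ptws T -> R} := fun w => shift y w / mass y.

Let shift_v y : shift y v = - low y.
Proof.
rewrite /shift vW big1 ?sub0r // => i /eqP ev.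
by move: (eU i); rewrite ev (negbTE vU).
Qed.

Let shift_e y i : shift y (e i) = y ord0 i - low y.
Proof.
rewrite /shift eW (big_pred1 i) // => j /=.
by apply/eqP/eqP => [|->//]; exact: enum_val_inj.
Qed.

Let low_le0 y : low y <= 0. Proof. exact: bigmin_le_id. Qed.
Let low_le y i : low y <= y ord0 i. Proof. exact: bigmin_le. Qed.

Let shift_ge0 y w : 0 <= shift y w.
Proof.
have [|wW] := boolP (w \in W); last by rewrite /shift (negbTE wW).
case/WP => [->|[i ->]]; first by rewrite shift_v oppr_ge0.
by rewrite shift_e subr_ge0.
Qed.

Let shift_eq0 y : exists2 w, w \in W & shift y w = 0.
Proof.
have : low y = 0 \/ exists i, low y = y ord0 i.
  rewrite /low; elim/big_ind: _ => [|a b Ha Hb|i _];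
    [by left| |by right; exists i].
  by rewrite /Num.min; case: ifP.
case=> [l0|[i li]]; first by exists v => //; rewrite shift_v l0 oppr0.
by exists (e i) => //; rewrite shift_e li subrr.
Qed.

(** If the mass vanishes, so do all the nonnegative shifted coordinates. At [v] this gives low(y) =
    0, so y = 0, which is not on the sphere. *)
Let mass_gt0 y : sphere R n y -> 0 < mass y.
Proof.
move=> Sy; rewrite lt_neqAle sumr_ge0 ?andbT;
  last by move=> w _; exact: shift_ge0.
apply/eqP => /esym/eqP; rewrite psumr_eq0; last by move=> w _; exact: shift_ge0.
move=> /allP s0; have {}s0 w : shift y w = 0.
  by apply/eqP; apply: (s0 w); rewrite mem_index_enum.
have l0 : low y = 0 by apply/eqP; rewrite -oppr_eq0 -shift_v s0.
move: Sy; rewrite /sphere /= big1 => [/esym/eqP|i _]; first by rewrite oner_eq0.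
by have := s0 (e i); rewrite shift_e l0 subr0 => ->; rewrite expr0n.
Qed.

Let of_sphere_realization y : sphere R n y ->
  realization R (simplex_boundary W) (of_sphere y).
Proof.
move=> Sy; have m0 := mass_gt0 y Sy; split.
- by move=> w; rewrite divr_ge0 // ltW.
- by rewrite -mulr_suml divff // gt_eqF.
- rewrite inE; apply/fintype.properP; split.
    apply/fintype.subsetP => w; rewrite carrierP /of_sphere /shift.
    by case: ifP => //; rewrite mul0r eqxx.
  have [w wW s0] := shift_eq0 y; exists w => //.
  by rewrite carrierP negbK /of_sphere s0 mul0r.
Qed.

(** If all differences vanish, x is constant on [W]; a vertex of [W] missing from the carrier makes
    the constant 0, against total mass 1. *)
Let norm_gt0 x : realization R (simplex_boundary W) x -> 0 < norm x.
Proof.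
move=> [x0 x1]; rewrite inE => /fintype.properP[xW [w wW]].
rewrite carrierP negbK => /eqP xw.
have s0 : 0 <= \sum_i diff x i ^+ 2 by apply: sumr_ge0 => i _; exact: sqr_ge0.
rewrite sqrtr_gt0 lt_neqAle s0 andbT; apply/eqP => /esym/eqP.
rewrite psumr_eq0; last by move=> i _; exact: sqr_ge0.
move=> /allP d0; have {}d0 i : x (e i) = x v.
  have := d0 i (mem_index_enum i); rewrite sqrf_eq0 subr_eq0 => /eqP //.
have xc u : u \in W -> x u = x v by case/WP => [->|[i ->]].
have xv : x v = 0 by rewrite -(xc w wW).
suff : \sum_u x u = 0 by rewrite x1 => /eqP; rewrite oner_eq0.
apply: big1 => u _; have [uW|uW] := boolP (u \in W); first by rewrite xc.
apply/eqP; apply: contraNT uW; rewrite -carrierP; exact: (fintype.subsetP xW).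
Qed.

Let to_sphere_sphere x : realization R (simplex_boundary W) x ->
  sphere R n (to_sphere x).
Proof.
move=> /norm_gt0 N0; rewrite /sphere /=.
under eq_bigr do rewrite mxE expr_div_n.
rewrite -mulr_suml; set S := \sum_i _; have S0 : 0 <= S.
  by apply: sumr_ge0 => i _; exact: sqr_ge0.
have NE : norm x ^+ 2 = S by exact: sqr_sqrtr.
by rewrite NE divff // -NE expf_neq0 // gt_eqF.
Qed.

Let to_sphereK x : realization R (simplex_boundary W) x ->
  of_sphere (to_sphere x) = x.
Proof.
move=> Bx; have N0 := norm_gt0 x Bx; case: Bx => [x0 x1].
rewrite inE => /fintype.properP[xW [w wW]].
rewrite carrierP negbK => /eqP xw.
(* The zero coordinate at [w] is the smallest one on [W]; subtracting x(v) and dividing by the norm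
   turns it into this minimum. *)
have lowE : low (to_sphere x) = - x v / norm x.
  apply/le_anti/andP; split.
    case/WP: wW xw => [->|[i ->]] xw; first by rewrite xw oppr0 mul0r.
    by apply: le_trans (low_le _ i) _; rewrite mxE /diff xw sub0r.
  apply/bigmin_geP; split; first by rewrite mulNr oppr_le0 divr_ge0 // ltW.
  move=> i _; rewrite mxE; apply: ler_wpM2r; first by rewrite invr_ge0 ltW.
  by rewrite /diff lerDr x0.
have shiftE u : shift (to_sphere x) u = x u / norm x.
  have [uW|uW] := boolP (u \in W); last first.
    rewrite /shift (negbTE uW).
    suff -> : x u = 0 by rewrite mul0r.
    by apply/eqP; apply: contraNT uW; rewrite -carrierP;
      exact: (fintype.subsetP xW).
  case/WP: uW => [->|[i ->]]; first by rewrite shift_v lowE mulNr opprK.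
  by rewrite shift_e lowE mxE /diff; ring.
have massE : mass (to_sphere x) = (norm x)^-1.
  by rewrite /mass; under eq_bigr do rewrite shiftE;
    rewrite -mulr_suml x1 mul1r.
apply/funext => u; rewrite /of_sphere shiftE massE invrK divfK // gt_eqF //.
Qed.

Let of_sphereK y : sphere R n y -> to_sphere (of_sphere y) = y.
Proof.
move=> Sy; have m0 := mass_gt0 y Sy.
have dE i : diff (of_sphere y) i = y ord0 i / mass y.
  by rewrite /diff /of_sphere shift_v shift_e; ring.
have NE : norm (of_sphere y) = (mass y)^-1.
  rewrite /norm; under eq_bigr do rewrite dE expr_div_n.
  rewrite -mulr_suml Sy mul1r -exprVn sqrtr_sqr ger0_norm //.
  by rewrite invr_ge0 ltW.
by apply/rowP => i; rewrite mxE dE NE invrK divfK // gt_eqF.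
Qed.

Lemma simplex_boundary_sphere :
  exists (f : realization R (simplex_boundary W) -> sphere R n)
         (g : sphere R n -> realization R (simplex_boundary W)),
  [/\ continuous f, continuous g, cancel f g & cancel g f].
Proof.
pose B := realization R (simplex_boundary W).
pose f (x : B) : sphere R n := @exist _ (fun z => z \in sphere R n) _
  (mem_set (to_sphere_sphere _ (set_valP x))).
pose g (y : sphere R n) : B := @exist _ (fun z => z \in B) _
  (mem_set (of_sphere_realization _ (set_valP y))).
have cB w : continuous (fun x : B => set_val x w).
  apply: (continuous_compose set_val _ _ (ptws_eval_continuous w)).
  exact: initial_continuous.
have cS i : continuous (fun y : sphere R n => set_val y ord0 i).
  apply: (continuous_compose set_val (fun y : 'rV[R]_n => y ord0 i)).
    exact: initial_continuous.
  exact: coord_continuous.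
exists f, g; split.
- apply: continuous_set_type; apply: continuous_rV => i.
  have -> : (fun x : B => set_val (f x) ord0 i) =
            (fun x : B => diff (set_val x) i / norm (set_val x)).
    by apply/funext => x; rewrite /= mxE.
  have cd j : continuous (fun x : B => diff (set_val x) j).
    exact: continuous_sub.
  apply: continuous_div => //; last by move=> x; rewrite gt_eqF // norm_gt0 //;
    exact: set_valP.
  apply: (continuous_compose _ Num.sqrt); last exact: sqrt_continuous.
  apply: continuous_sum => j _; exact: continuous_mul.
- apply: continuous_set_type; apply: continuous_ptws => w.
  have cs u : continuous (fun y : sphere R n => shift (set_val y) u).
    rewrite /shift; case: (u \in W); last exact: continuous_const.
    apply: continuous_sub; first exact: continuous_sum.
    by apply: continuous_bigmin => //; exact: continuous_const.
  apply: continuous_div => //; first by apply: continuous_sum.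
  by move=> y; rewrite gt_eqF // mass_gt0 //; exact: set_valP.
- by move=> x; apply: val_inj; rewrite /= to_sphereK //; exact: set_valP.
- by move=> y; apply: val_inj; rewrite /= of_sphereK //; exact: set_valP.
Qed.
End Sphere.

(** * Degenerate cases and conclusion *)

Lemma dual_of_full {T : finType} (V : {set T}) (K : {set {set T}}) :
  simplicial_complex K -> V \in K -> alexander_dual V K = finset.set0.
Proof.
move=> [_ cK] VK; apply/finset.setP => s; rewrite !inE.
by rewrite (cK _ _ VK) ?andbF // finset.subsetDl.
Qed.

(** Both complexes have the empty set as their only simplex. *)
Lemma simplex_boundary_set1 {T : finType} (v w : T) :
  simplex_boundary [set v] = simplex_boundary [set w].
Proof.
have E u : simplex_boundary [set u] = [set finset.set0].
  apply/finset.setP => s; rewrite !inE finset.properEcard finset.cards1 ltnS.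
  by rewrite leqn0 finset.cards_eq0; case: eqP => [->|];
    rewrite ?finset.sub0set ?andbF.
by rewrite !E.
Qed.

(* A set coerces to a type (via [set_type]) that carries the subspace topology. *)
Theorem corollary2p6 (R : realType) (T : finType) (K : {set {set T}})
    (V : {set T}) (hK : simplicial_complex K) (hV : vertices K \subset V)
    (hcollapse : exists t : {set T}, collapses K (simplex_boundary t)) :
  exists n : nat,
    homotopy_equivalent R
      (realization R (alexander_dual V K)) (sphere R n).
Proof.
have [VK|VK] := boolP (V \in K).
  (* Both spaces are empty: the empty family has no points, and in R^0 the sum of squares is 0, not
     1. *)
  exists 0%N; rewrite dual_of_full //; set A := finset.set0.
  have noA (x : realization R A) : False.
    by have [_ _] := set_valP x; rewrite inE.
  have noS (y : sphere R 0) : False.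
    by have := set_valP y; rewrite /sphere /= big_ord0 => /esym/eqP;
      rewrite oner_eq0.
  apply: (retracts_homotopy_equivalent A A A _ (fun x => False_rect _ (noA x))
    (fun y => False_rect _ (noS y))); try exact: deformation_retracts_refl.
  - by move=> x; case: (noA x).
  - by move=> y; case: (noS y).
  - by move=> x; case: (noA x).
  - by move=> y; case: (noS y).
case: hcollapse => t Kt.
have [[+ _] LV _ ret] :=
  @dual_retracts R T _ _ _ hK (subset_vertices _ _ hK hV) VK Kt.
(* The empty simplex is a proper subset of [t], so [t] has a vertex. *)
rewrite inE => t0.
have [t' [v [t'V vt' tt']]] : exists (t' : {set T}) (v : T),
    [/\ t' \subset V, v \in t' & simplex_boundary t = simplex_boundary t'].
  have [tV|/subsetPn[w wt wV]] := boolP (t \subset V).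
    have /fintype.properP[_ [v vt _]] := t0.
    by exists t, v.
  (* All simplices of the boundary lie in [V], so {w} is not one of them: it is not a proper subset
     of [t]. *)
  have tw : t = [set w].
    apply/esym/eqP; apply: contraNT wV => nt.
    rewrite -finset.sub1set LV // inE finset.properEneq nt.
    by rewrite finset.sub1set.
  (* [V] is nonempty because [K] contains the empty set but not [V]. *)
  have /finset.set0Pn[v vV] : V != finset.set0.
    by apply: contraNneq VK => ->; case: hK.
  exists [set v], v; split; rewrite ?finset.sub1set ?finset.set11 // tw.
  exact: simplex_boundary_set1.
move: ret; rewrite tt' => ret.
have vU : v \notin V :\: t' by rewrite inE vt'.
have [f [g [cf cg fK gK]]] := @simplex_boundary_sphere R T v _ vU.
exists #|V :\: t'|.
apply: (retracts_homotopy_equivalent _ _ _ _ f g ret) => //.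
exact: dual_boundary_retracts.
Qed.
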